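(* Let $G=(V,E)$ be a graph and $u\notin V$. The algorithm ACCN with primary instance $G$ is feasible, i.e. it terminates in finitely many computations on the (secondary) instance $G\vee u$.
   Context: All graphs are finite (with non-empty vertex set), simple, undirected and loop-free. For $u\notin V$, $G\vee u$ is the graph with vertex set $W=V\cup\{u\}$ whose edges are the edges of $G$ together with all $\{u,x\}$, $x\in V$. In $G\vee u$, $C(x)=N(x)\cup\{x\}$ is the closed neighbourhood of $x$. For $A\subset W$ and $z\in A$, $d_z(A)$ is the degree of $z$ in the subgraph of $G\vee u$ induced by $A$. Algorithm ACCN. Input: the vertex set and the adjacency matrix of the primary instance $G$. Phase 1: construct the vertex set and the adjacency matrix of the secondary instance $G\vee u$. Phase 2: for each $y\in W$: put $A=C(y)$; for each $z\in A$ compute $d_z(A)$; compute the largest $k$ such that there are at least $k$ vertices $z\in A$ with $d_z(A)\ge k$; set $c(y{:}u)=k+1$. Phase 3: for each $y\in W$ set $c^*(y{:}u)=c(y{:}u)$. Then, for each $y\in W$ with $y\ne u$: compute the largest $p$ such that there are at least $p$ vertices $z\in C(y)$, including $y$ and $u$ (i.e. $y$ and $u$ are among these vertices), such that $p\le c^*(z{:}u)$; set $c^*(y{:}u)=p$. Finally compute the largest $p$ such that there are at least $p$ vertices $z\in W$, including $u$, such that $p\le c^*(z{:}u)$; set $c^*(u{:}u)=p$ and $c^*(G\vee u)=c^*(u{:}u)$. Return $c^*(G\vee u)$. *)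

(* Defs.v *)
From mathcomp Require Import all_boot.

Set Implicit Arguments.
Unset Strict Implicit.
Unset Printing Implicit Defensive.

Section TransitionSystem.

Variables (S : Type) (step : S -> S -> Prop) (final : S -> Prop).

Inductive steps : nat -> S -> S -> Prop :=
| steps0 s : steps 0 s s
| stepsS n s s' s'' : step s s' -> steps n s' s'' -> steps n.+1 s s''.

(* No run from s gets stuck in an instruction that cannot be carried out, and
   all runs are bounded in length; so every run can be continued until it
   reaches a final state, which happens after at most N steps. *)
Definition feasible (s : S) : Prop :=
  (forall n t, steps n s t -> final t \/ exists t', step t t') /\
  (exists N, forall n t, steps n s t -> n <= N).

End TransitionSystem.

Definition largest (P : pred nat) (k : nat) : Prop :=
  P k /\ forall j, P j -> j <= k.

Definition adjacency (X : finType) : Type := {ffun X * X -> bool}.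

Definition adjacency_of (X : finType) (e : rel X) : adjacency X :=
  [ffun q => e q.1 q.2].

Definition assign (X : finType) (R : Type) (f : {ffun X -> R}) (x : X) (v : R) :
  {ffun X -> R} := [ffun z => if z == x then v else f z].

(* C(y) and d_z(A) in the graph on X with adjacency matrix M. *)
Definition closed_nbhd (X : finType) (M : adjacency X) (y : X) : {set X} :=
  y |: [set z | M (y, z)].

Definition induced_degree (X : finType) (M : adjacency X) (A : {set X}) (z : X)
  : nat := #|[set x in A | M (z, x)]|.

Section ACCN.

Variable V : finType.

(* The vertex set of the secondary instance is option V: the new vertex u is
   None, and a vertex x of G is Some x. *)
Local Notation W := (option V).
Local Notation u := (None : W).

(* The adjacency matrix entry of G \/ u at (x, y), read off that of G. *)
Definition join_entry (M : adjacency V) (x y : W) : bool :=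
  match x, y with
  | Some a, Some b => M (a, b)
  | None, None => false
  | _, _ => true
  end.

(* There are at least k vertices z in A with d z >= k. *)
Definition phase2_ok (A : {set W}) (d : {ffun W -> nat}) : pred nat :=
  fun k => k <= #|[set z in A | k <= d z]|.

(* There are at least p vertices z in B, including all those of I, with
   p <= cs z. *)
Definition phase3_ok (B I : {set W}) (cs : {ffun W -> nat}) : pred nat :=
  fun p => let S := [set z in B | p <= cs z] in (I \subset S) && (p <= #|S|).

(* Control point and memory.  In each loop, the set argument holds the items
   that have not been processed yet.  In Degrees, the pending vertices y of the
   outer loop come first, and the pending z in A of the inner loop last. *)
Inductive state : Type :=
| Input of adjacency V
| Phase1 of adjacency V & {set W * W} & adjacency W
| Phase2 of adjacency W & {set W} & {ffun W -> nat}
| Degrees of adjacency W & {set W} & {ffun W -> nat}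
    & W & {set W} & {ffun W -> nat} & {set W}
| Copy of adjacency W & {ffun W -> nat} & {set W} & {ffun W -> nat}
| Phase3 of adjacency W & {set W} & {ffun W -> nat}
| Return of nat.

(* The loops "for each ..." prescribe no order: any pending item may be
   processed next.  Arrays are created filled with 0 (or false). *)
Inductive ACCN_step : state -> state -> Prop :=
| step_vertices M0 :
    ACCN_step (Input M0) (Phase1 M0 [set: W * W] [ffun=> false])
| step_entry M0 (T : {set W * W}) M x y : (x, y) \in T ->
    ACCN_step (Phase1 M0 T M)
      (Phase1 M0 (T :\ (x, y)) (assign M (x, y) (join_entry M0 x y)))
| step_phase1_end M0 M :
    ACCN_step (Phase1 M0 set0 M) (Phase2 M [set: W] [ffun=> 0])
| step_nbhd M (T : {set W}) c y : y \in T ->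
    ACCN_step (Phase2 M T c)
      (Degrees M (T :\ y) c y (closed_nbhd M y) [ffun=> 0] (closed_nbhd M y))
| step_degree M T c y A d (D : {set W}) z : z \in D ->
    ACCN_step (Degrees M T c y A d D)
      (Degrees M T c y A (assign d z (induced_degree M A z)) (D :\ z))
| step_c M T c y A d k : largest (phase2_ok A d) k ->
    ACCN_step (Degrees M T c y A d set0) (Phase2 M T (assign c y k.+1))
| step_phase2_end M c :
    ACCN_step (Phase2 M set0 c) (Copy M c [set: W] [ffun=> 0])
| step_copy M c (T : {set W}) cs y : y \in T ->
    ACCN_step (Copy M c T cs) (Copy M c (T :\ y) (assign cs y (c y)))
| step_copy_end M c cs :
    ACCN_step (Copy M c set0 cs) (Phase3 M [set~ u] cs)
| step_cstar M (T : {set W}) cs y p : y \in T ->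
    largest (phase3_ok (closed_nbhd M y) [set y; u] cs) p ->
    ACCN_step (Phase3 M T cs) (Phase3 M (T :\ y) (assign cs y p))
| step_return M cs p :
    largest (phase3_ok [set: W] [set u] cs) p ->
    ACCN_step (Phase3 M set0 cs) (Return p).

Definition returned (s : state) : Prop := exists p, s = Return p.

End ACCN.

(* Main.v *)
Require Import Defs.
From mathcomp Require Import all_boot.
From mathcomp Require Import zify.

(** A run can only be endless if some loop is, and it can only get stuck at one
    of the searches for a largest integer.

    Endless runs are excluded by [rank], a bound on the number of instructions
    still to be carried out: each loop runs over a finite set that shrinks by
    one item per turn, and a loop is entered with at most all of [W] (or
    [W * W]) pending.  It decreases at every step
    ([ACCN_step_rank]).

    As for the searches, each of their conditions bounds the integer by the
    cardinality of a finite set, so a largest solution exists as soon as one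
    solution does; the candidate is 0.  In Phase 2 it always satisfies the
    condition.  In Phase 3 it does if and only if the vertices that have to be
    counted belong to the set where the counting takes place, which for
    [y != u] means that [u] lies in [C(y)].  This is where the join matters:
    [u] is adjacent to all vertices of [G].  The algorithm only knows this from
    the matrix written by Phase 1, so that the entries [(x, u)] are carried
    along the run as an invariant ([well_formed]), together with the
    fact that [u] is never pending in Phase 3. *)

Set Implicit Arguments.
Unset Strict Implicit.
Unset Printing Implicit Defensive.

Section Feasibility.

Variables (S : Type) (step : S -> S -> Prop) (final : S -> Prop).

Lemma steps_invariant (inv : S -> Prop) :
  (forall s t, inv s -> step s t -> inv t) ->
  forall n s t, steps step n s t -> inv s -> inv t.
Proof.
move=> inv_step n s t; elim=> [//|{}n {}s s' {}t st _ IH inv_s].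
exact/IH/(inv_step s).
Qed.

Lemma steps_rank (rank : S -> nat) :
  (forall s t, step s t -> rank t < rank s) ->
  forall n s t, steps step n s t -> n <= rank s.
Proof.
move=> rank_step n s t; elim=> [//|{}n {}s s' {}t st _ IH].
exact: leq_ltn_trans IH (rank_step _ _ st).
Qed.

Lemma feasible_of_invariant_rank (inv : S -> Prop) (rank : S -> nat) s :
  (forall s t, inv s -> step s t -> inv t) ->
  (forall s, inv s -> final s \/ exists t, step s t) ->
  (forall s t, step s t -> rank t < rank s) ->
  inv s -> feasible step final s.
Proof.
move=> inv_step progress rank_step inv_s; split=> [n t st|].
  exact/progress/(steps_invariant inv_step st).
by exists (rank s) => n t; apply: steps_rank.
Qed.

End Feasibility.

Lemma largest_exists (P : pred nat) m :
  P 0 -> (forall k, P k -> k <= m) -> exists k, largest P k.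
Proof.
move=> P0 P_le; have exP : exists k, P k by exists 0.
by case: (ex_maxnP exP P_le) => k Pk k_max; exists k.
Qed.

Section ACCN.

Variable V : finType.
Local Notation W := (option V).
Local Notation u := (None : W).

Lemma phase2_largest (A : {set W}) (d : {ffun W -> nat}) :
  exists k, largest (phase2_ok A d) k.
Proof.
apply: (@largest_exists _ #|A|) => // k /leq_trans; apply.
by apply/subset_leq_card/subsetP => z; rewrite inE => /andP[].
Qed.

Lemma phase3_largest (B I : {set W}) (cs : {ffun W -> nat}) :
  I \subset B -> exists p, largest (phase3_ok B I cs) p.
Proof.
move=> /subsetP sIB; apply: (@largest_exists _ #|B|) => [|p].
  by rewrite /phase3_ok andbT; apply/subsetP => z /sIB; rewrite inE andbT.
case/andP=> _ /leq_trans; apply.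
by apply/subset_leq_card/subsetP => z; rewrite inE => /andP[].
Qed.

(** Only the entries in the column of [u] are recorded: they are all that the
    search at [y] in Phase 3 relies on, since [y] is in [C(y)] anyway. *)
Definition sees_u (M : adjacency W) : Prop := forall x : V, M (Some x, u).

Lemma required_sub_closed_nbhd M (y : W) :
  sees_u M -> y != u -> [set y; u] \subset closed_nbhd M y.
Proof.
case: y => // x /(_ x) Mxu _; apply/subsetP => z.
by rewrite !inE => /orP[]/eqP->; rewrite ?eqxx ?Mxu.
Qed.

Definition well_formed (s : state V) : Prop :=
  match s with
  | Phase1 _ T M => forall x : V, (Some x, u) \notin T -> M (Some x, u)
  | Phase2 M _ _ | Degrees M _ _ _ _ _ _ | Copy M _ _ _ => sees_u M
  | Phase3 M T _ => sees_u M /\ u \notin T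
  | _ => True
  end.

Lemma ACCN_step_well_formed (s t : state V) :
  well_formed s -> ACCN_step s t -> well_formed t.
Proof.
move=> wf st; case: st wf => //=.
- by move=> M0 _ x; rewrite inE.
- move=> M0 T M a b _ MT x; rewrite !inE ffunE.
  by case: eqP => [[<- <-] //|_]; apply: MT.
- by move=> M0 M MT x; apply: MT; rewrite inE.
- by move=> M c cs Mu; split; rewrite // !inE.
- by move=> M T cs y p _ _ [Mu uT]; split; rewrite // !inE negb_and uT orbT.
Qed.

Lemma ACCN_progress (s : state V) :
  well_formed s -> returned s \/ exists t, ACCN_step s t.
Proof.
case: s => [M0|M0 T M|M T c|M T c y A d D|M c T cs|M T cs|p] /= wf; last first.
  by left; exists p.
all: right.
- have [T0|[y yT]] := set_0Vmem T.
    have [p max_p] := @phase3_largest [set: W] [set u] cs (subsetT _).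
    by rewrite T0; exists (Return V p); apply: step_return max_p.
  case: wf => Mu uT.
  (* [y != u] because [u] is not pending. *)
  have y_neq_u : y != u by apply: contraNneq uT => <-.
  have [p max_p] := phase3_largest cs (required_sub_closed_nbhd Mu y_neq_u).
  by eexists; apply: step_cstar yT max_p.
- have [->|[y yT]] := set_0Vmem T; eexists; first exact: step_copy_end.
  exact: step_copy yT.
- have [->|[z zD]] := set_0Vmem D; last by eexists; apply: step_degree zD.
  by have [k max_k] := phase2_largest A d; eexists; apply: step_c max_k.
- have [->|[y yT]] := set_0Vmem T; eexists; first exact: step_phase2_end.
  exact: step_nbhd yT.
- have [->|[[x y] xyT]] := set_0Vmem T; eexists; first exact: step_phase1_end.
  exact: step_entry xyT.
- by eexists; apply: step_vertices.
Qed.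

Local Notation w := #|V|.+1.

(** With [w] vertices in [W], one turn of the outer loop of Phase 2 costs at
    most [w + 2] steps: computing the neighbourhood, at most [w] degrees, and
    the search.  The additive constants bound the costs of the later phases
    when all their items are pending, plus the steps that pass from one phase to
    the next. *)
Definition rank (s : state V) : nat :=
  match s with
  | Return _ => 0
  | Phase3 _ T _ => #|T| + 1
  | Copy _ _ T _ => #|T| + (w + 2)
  | Phase2 _ T _ => #|T| * (w + 2) + (2 * w + 3)
  | Degrees _ T _ _ _ _ D => #|D| + 1 + #|T| * (w + 2) + (2 * w + 3)
  | Phase1 _ T _ => #|T| + (w * (w + 2) + (2 * w + 4))
  | Input _ => w * w + (w * (w + 2) + (2 * w + 5))
  end.

Lemma card_le_w (A : {set W}) : #|A| <= w.
Proof. by rewrite -card_option max_card. Qed.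

Lemma ACCN_step_rank (s t : state V) : ACCN_step s t -> rank t < rank s.
Proof.
(* Unfolding this marker turns equal cardinalities into one atom for [lia]. *)
rewrite /rank; case; rewrite ?/reverse_coercion.
- by move=> M0; rewrite cardsT card_prod card_option; lia.
- by move=> M0 T M x y xyT; rewrite (cardsD1 (x, y) T) xyT; lia.
- by move=> M0 M; rewrite cardsT card_option cards0; lia.
- move=> M T c y yT; rewrite (cardsD1 y T) yT mulnDl.
  by move: #|closed_nbhd M y| (card_le_w (closed_nbhd M y)) => m; lia.
- by move=> M T c y A d D z zD; rewrite (cardsD1 z D) zD; lia.
- by move=> M T c y A d k _; rewrite cards0; lia.
- by move=> M c; rewrite cardsT card_option cards0; lia.
- by move=> M c T cs y yT; rewrite (cardsD1 y T) yT; lia.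
- move=> M c cs; rewrite cards0.
  by move: #|[set~ u]| (card_le_w [set~ u]) => m; lia.
- by move=> M T cs y p yT _; rewrite (cardsD1 y T) yT; lia.
- by move=> M cs p _; lia.
Qed.

End ACCN.

Theorem proposition4p1 (V : finType) (E : rel V)
    (symE : symmetric E) (irrE : irreflexive E) (V_nonempty : 0 < #|V|) :
  feasible (@ACCN_step V) (@returned V) (Input (adjacency_of E)).
Proof.
exact: (feasible_of_invariant_rank (@ACCN_step_well_formed V)
  (@ACCN_progress V) (@ACCN_step_rank V)).
Qed.
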